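(* Let $H$ be a complex Hilbert space and let $A,B,T$ be not necessarily bounded operators in $H$ such that $A$ is self-adjoint, $B$ is symmetric with $B^{-1}\in B(H)$ (hence $B$ is self-adjoint) and $T$ is symmetric. Assume further that $AB\subset T$. Then: (1) $AB\subset BA$. (2) $BA$ is normal. (3) $\overline{T}=(BA)^*$. (4) $T$ is essentially self-adjoint. If $T$ is also closed, then $BA$ is self-adjoint and $T=BA$ and $T=\overline{AB}$.
   Context: Operators are linear, not necessarily bounded, with domain $D(\cdot)\subset H$ a linear subspace. $B(H)$ is the set of bounded operators defined on all of $H$. $S\subset T$ means $D(S)\subset D(T)$ and $Sx=Tx$ for all $x\in D(S)$. The product $ST$ has domain $D(ST)=\{x\in D(T): Tx\in D(S)\}$ and $(ST)x=S(Tx)$. $B^{-1}\in B(H)$ means that there is an operator $C=B^{-1}\in B(H)$ with $CB\subset I$ and $BC=I$, where $I$ is the identity on $H$. A densely defined operator $S$ is symmetric if $S\subset S^*$, self-adjoint if $S=S^*$, and essentially self-adjoint if its closure $\overline{S}$ is self-adjoint. $S$ is normal if it is densely defined, closed and $SS^*=S^*S$ (equality including domains). *)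

(* Defs.v *)
From mathcomp Require Import all_boot all_order all_algebra.
From mathcomp Require Import complex.
From mathcomp Require Import all_classical all_reals all_analysis.

Set Implicit Arguments.
Unset Strict Implicit.
Unset Printing Implicit Defensive.

Import Order.TTheory GRing.Theory Num.Theory.
Import numFieldNormedType.Exports.

Local Open Scope classical_set_scope.
Local Open Scope ring_scope.
Local Open Scope complex_scope.

(* A complex Hilbert space is given by a complete normed module [H] over [R[i]]
   together with a positive definite Hermitian form [ip] on [H] (linear in the
   first argument, conjugate-linear in the second) that induces the norm. *)
Definition hilbert (R : realType) (H : completeNormedModType R[i])
    (ip : {dot H for Num.Def.conjC}) : Prop :=
  forall x : H, ip x x = `|x| ^+ 2.

Section Operators.
Context {R : realType} {H : completeNormedModType R[i]}.
Implicit Types (a : R[i]) (x y z : H) (G : set (H * H)).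

(* The values of [app] outside [dom] are irrelevant: every notion below depends
   only on the graph of the operator. *)
Record operator := Operator {
  dom : set H;
  app :> H -> H;
  dom0 : dom 0;
  domP : forall a x y, dom x -> dom y -> dom (a *: x + y);
  appP : forall a x y, dom x -> dom y -> app (a *: x + y) = a *: app x + app y
}.

Implicit Types S T : operator.

Definition op_sub S T : Prop :=
  dom S `<=` dom T /\ (forall x, dom S x -> S x = T x).

(* Leibniz equality of [operator] would also compare the values outside the
   domain. *)
Definition op_eq S T : Prop := op_sub S T /\ op_sub T S.

Definition op_id : operator :=
  @Operator setT id I (fun _ _ _ _ _ => I) (fun _ _ _ _ _ => erefl).

Lemma op_app0 S : S 0 = 0.
Proof.
have := appP (-1) (dom0 S) (dom0 S).
by rewrite scaler0 addr0 scaleN1r addNr.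
Qed.

Section Product.
Variables S T : operator.

Definition mul_dom : set H := [set x | dom T x /\ dom S (T x)].

Let mul_dom0 : mul_dom 0.
Proof. by split; [exact: dom0 | rewrite op_app0; exact: dom0]. Qed.

Let mul_domP a x y : mul_dom x -> mul_dom y -> mul_dom (a *: x + y).
Proof.
move=> [Tx STx] [Ty STy]; split; first exact: domP.
by rewrite appP//; exact: domP.
Qed.

Let mul_appP a x y : mul_dom x -> mul_dom y ->
  S (T (a *: x + y)) = a *: S (T x) + S (T y).
Proof. by move=> [Tx STx] [Ty STy]; rewrite !appP. Qed.

Definition op_mul : operator := Operator mul_dom0 mul_domP mul_appP.
End Product.

Definition bounded_everywhere S : Prop :=
  dom S = setT /\ exists M : R[i], forall x, `|S x| <= M * `|x|.

Definition boundedly_invertible S : Prop :=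
  exists C : operator, [/\ bounded_everywhere C,
    op_sub (op_mul C S) op_id & op_eq (op_mul S C) op_id].

Definition graph S : set (H * H) := [set p | dom S p.1 /\ S p.1 = p.2].

Definition operator_graph G : Prop :=
  [/\ G (0, 0),
      forall a x y x' y', G (x, y) -> G (x', y') ->
        G (a *: x + x', a *: y + y')
    & forall x y z, G (x, y) -> G (x, z) -> y = z].

Section OfGraph.
Variables (G : set (H * H)) (GP : operator_graph G).

Definition graph_app x : H := xget 0 [set y | G (x, y)].

Lemma graph_appP x y : G (x, y) -> graph_app x = y.
Proof.
move=> Gxy; rewrite /graph_app; case: GP => _ _; apply; last exact: Gxy.
by case: xgetP => [z _ //|/(_ y)].
Qed.

Let graph_dom : set H := [set x | exists y, G (x, y)].

Let graph_dom0 : graph_dom 0.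
Proof. by exists 0; case: GP. Qed.

Let graph_domP a x y : graph_dom x -> graph_dom y -> graph_dom (a *: x + y).
Proof.
move=> [x' Gx] [y' Gy]; exists (a *: x' + y').
by case: GP => _ + _; exact.
Qed.

Let graph_app_lin a x y : graph_dom x -> graph_dom y ->
  graph_app (a *: x + y) = a *: graph_app x + graph_app y.
Proof.
move=> [x' Gx] [y' Gy]; rewrite (graph_appP Gx) (graph_appP Gy).
by apply: graph_appP; case: GP => _ + _; exact.
Qed.

Definition op_of_operator_graph : operator :=
  Operator graph_dom0 graph_domP graph_app_lin.
End OfGraph.

Fact triv_domP a x y : [set 0] x -> [set 0] y -> [set 0] (a *: x + y).
Proof. by move=> -> ->; rewrite /= scaler0 addr0. Qed.

Fact triv_appP a x y : [set 0] x -> [set 0] y ->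
  0 = a *: 0 + 0 :> H.
Proof. by rewrite scaler0 addr0. Qed.

Definition op_triv : operator :=
  @Operator [set 0] (fun=> 0) erefl triv_domP triv_appP.

(* The operator with graph [G]; the value is a dummy (the zero operator on {0})
   when [G] is not the graph of an operator. *)
Definition op_of_graph G : operator :=
  match pselect (operator_graph G) with
  | left GP => op_of_operator_graph GP
  | right _ => op_triv
  end.

Lemma graph_op_of_graph G : operator_graph G -> graph (op_of_graph G) = G.
Proof.
rewrite /op_of_graph; case: pselect => // GP _.
apply/seteqP; split => -[x y] /=.
  by move=> [[z Gxz]] /=; rewrite (graph_appP GP Gxz) => <-.
by move=> Gxy; split; [exists y | exact: graph_appP].
Qed.

Definition densely_defined S : Prop := dense (dom S).

Definition closed_operator S : Prop := closed (graph S).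

(* The closure of a closable operator; a dummy for a non-closable one. *)
Definition op_closure S : operator := op_of_graph (closure (graph S)).

Definition closable S : Prop :=
  exists2 T, op_sub S T & closed_operator T.

Lemma op_closureE S : closable S -> graph (op_closure S) = closure (graph S).
Proof.
move=> [T [STd STa] Tc]; apply: graph_op_of_graph; split.
- by apply: subset_closure; split; [exact: dom0 | exact: op_app0].
- move=> a x y x' y' Sxy Sxy'.
  pose f (p : (H * H) * (H * H)) : H * H := a *: p.1 + p.2.
  have fc : continuous f.
    move=> p; apply: cvgD; last exact: cvg_snd.
    by apply: cvgZl_tmp; exact: cvg_fst.
  move=> B /(fc ((x, y), (x', y')))[[B1 B2] /= [/Sxy[p [Sp Bp]] /Sxy'[q [Sq Bq]]]].
  move=> /(_ (p, q) (conj Bp Bq)) fB; exists (f (p, q)); split => //.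
  case: Sp => Sp Spe; case: Sq => Sq Sqe.
  by split; [exact: domP | rewrite /f /= appP// Spe Sqe].
- have ST : closure (graph S) `<=` graph T.
    apply: (subset_trans _ Tc); apply: closureS => -[x z] [/= Sx <-].
    by split => /=; [exact: STd | rewrite STa].
  by move=> x y z /ST[_ /=] <- /ST[_ /=] <-.
Qed.

Variable ip : {dot H for Num.Def.conjC}.

Definition adjoint_graph S : set (H * H) :=
  [set p | forall x, dom S x -> ip (S x) p.1 = ip x p.2].

(* The adjoint of a densely defined operator; a dummy otherwise. *)
Definition adjoint S : operator := op_of_graph (adjoint_graph S).

Lemma adjointE S : hilbert ip -> densely_defined S ->
  graph (adjoint S) = adjoint_graph S.
Proof.
move=> ipE Sd; apply: graph_op_of_graph; split.
- by move=> x _; rewrite /= !linear0r.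
- move=> a x y x' y' Sxy Sxy' z Sz /=.
  by move: (Sxy z Sz) (Sxy' z Sz); rewrite /= !linearPr => /= -> ->.
- move=> x y z Sxy Sxz; apply/eqP; rewrite -subr_eq0; apply/negPn/negP.
  set w := y - z => w0.
  have [u [wu Su]] : ball w `|w| `&` dom S !=set0.
    apply: Sd; last exact: ball_open.
    by exists w; apply: ballxx; rewrite normr_gt0.
  have ipuw : ip u w = 0.
    by move: (Sxy u Su) (Sxz u Su); rewrite /w linearBr /= => <- <-; rewrite subrr.
  have ipwu : ip w u = 0.
    by rewrite hermC/= ipuw rmorph0 mulr0.
  move: wu; rewrite -ball_normE/= => /lt_geF/negP; apply.
  rewrite -(@ler_pXn2r _ 2) ?nnegrE// -!ipE.
  by rewrite [leRHS]dnormB /= ipwu conjC0 addr0 subr0 lerDl ipE exprn_ge0.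
Qed.

Definition symmetric_operator S : Prop :=
  densely_defined S /\ op_sub S (adjoint S).

Definition self_adjoint S : Prop :=
  densely_defined S /\ op_eq S (adjoint S).

Definition essentially_self_adjoint S : Prop :=
  densely_defined S /\ self_adjoint (op_closure S).

Definition normal_operator S : Prop :=
  [/\ densely_defined S, closed_operator S
    & op_eq (op_mul S (adjoint S)) (op_mul (adjoint S) S)].

End Operators.

Arguments operator {R} H.

(* Main.v *)
From HB Require Import structures.
Require Import Defs.
From mathcomp Require Import all_boot all_order all_algebra.
From mathcomp Require Import complex.
From mathcomp Require Import all_classical all_reals all_analysis.
From mathcomp Require Import ring lra.

(** Write C for the bounded inverse of B; it is symmetric because B is. Since
    A B C p = A p for p in D(A), the symmetry of T on D(A B) = C D(A) reads
    <A p, C q> = <C p, A q> for all p, q in D(A). As A is self-adjoint, this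
    says that C maps D(A) into itself and commutes with A there
    ([inverse_commute]), which is A B <= B A. The same kind of computation shows
    that the adjoint of A B is B A ([adjoint_AB]), so B A is closed.

    The heart of the proof is that the graph of A B is dense in the graph of B A
    ([closure_AB]). By orthogonal projection in H x H it suffices that a point
    (y, v) of the graph of B A orthogonal to all (C p, A p), p in D(A), is zero.
    Membership in the graph gives A y = C v, and orthogonality gives, through
    the self-adjointness of A, that v is in D(A) with A v = - C y. Hence
    A (A y) = A C v = C A v = - C C y, so that |A y|^2 = - |C y|^2: then C y = 0
    and C v = A y = 0, and y = v = 0 because C is injective.

    As A B is symmetric with adjoint B A, passing to the closure makes B A
    symmetric, hence self-adjoint ([BA_self_adjoint]) and in particular normal.
    Finally A B <= T <= T* <= (A B)* = B A, so T has the same closure as A B,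
    namely B A = (B A)*, and every other claim follows.

    No spectral theory is used, only the projection theorem
    ([orthogonal_projection]), which is proved with a minimizing filter. It is
    stated for an inner product comparable to the norm, since the norm of H x H
    is the maximum norm. *)

Set Implicit Arguments.
Unset Strict Implicit.
Unset Printing Implicit Defensive.

Import Order.TTheory GRing.Theory Num.Theory.
Import numFieldNormedType.Exports.

Local Open Scope classical_set_scope.
Local Open Scope ring_scope.
Local Open Scope complex_scope.

(** * The projection theorem *)

Lemma prod_cauchy_cvg (U V : completeType) (F : set_system (U * V)) :
  ProperFilter F -> cauchy F -> exists l : U * V, F --> l.
Proof.
move=> FF Fc.
have Fc1 : cauchy (fst @ F).
  move=> E entE; have [[P Q] [FP FQ] PQE] := Fc _ (prod_entP entE entourageT).
  exists (fst @` P, fst @` Q).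
    by split; [apply: filterS FP | apply: filterS FQ] => p /= ?; exists p.
  by move=> [_ _] [/= [p Pp <-] [q Qq <-]]; have [] := PQE (p, q) (conj Pp Qq).
have Fc2 : cauchy (snd @ F).
  move=> E entE; have [[P Q] [FP FQ] PQE] := Fc _ (prod_entP entourageT entE).
  exists (snd @` P, snd @` Q).
    by split; [apply: filterS FP | apply: filterS FQ] => p /= ?; exists p.
  by move=> [_ _] [/= [p Pp <-] [q Qq <-]]; have [] := PQE (p, q) (conj Pp Qq).
exists (lim (fst @ F), lim (snd @ F)).
rewrite [F in F --> _](_ : F = (fun p => (p.1, p.2)) @ F).
  by apply: cvg_pair; exact: cauchy_cvg.
by rewrite (_ : (fun p => _) = id) // funeqE => -[].
Qed.

(** A quantitative orthogonality: if moving u along h cannot bring the squared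
    norm of u below d, then u is almost orthogonal to h, with an error that
    vanishes when the squared norm of u is d. With d = 0 this is the
    Cauchy-Schwarz inequality. *)
Lemma dnorm_min (C : numClosedFieldType) (U : lmodType C)
    (b : {dot U for Num.Def.conjC}) (d : C) (u h : U) :
  (forall a, d <= b (u - a *: h) (u - a *: h)) ->
  `|b u h| ^+ 2 <= (b u u - d) * b h h.
Proof.
move=> dmin.
have [->|h0] := eqVneq h 0; first by rewrite !linear0r normr0 expr0n.
have bh : 0 < b h h by rewrite dnorm_gt0.
have bhR : Num.conj (b h h) = b h h by rewrite conj_Creal// ger0_real// ltW.
rewrite -ler_pdivrMr// lerBrDr -lerBrDl.
(* this multiple of h is the one that minimizes the squared norm *)
apply: (le_trans (dmin (b u h / b h h))).
rewrite dnormB dnormZ linearZr_LR /= rmorphM fmorphV/= bhR.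
rewrite normf_div (gtr0_norm bh) expr_div_n !normCK.
rewrite le_eqVlt; apply/orP; left; apply/eqP.
rewrite !rmorphM fmorphV/= bhR conjCK.
by field; rewrite gt_eqF.
Qed.

Lemma parallelogram (C : numClosedFieldType) (U : lmodType C)
    (b : {dot U for Num.Def.conjC}) u v :
  b (u + v) (u + v) + b (u - v) (u - v) = (b u u + b v v) *+ 2.
Proof. by rewrite dnormD dnormB/= addrACA subrr addr0 mulr2n. Qed.

Lemma CauchySchwarz_dot (C : numClosedFieldType) (U : lmodType C)
    (b : {dot U for Num.Def.conjC}) u v :
  `|b u v| ^+ 2 <= b u u * b v v.
Proof.
by rewrite -{1}[b u u]subr0; apply: dnorm_min => a; rewrite dnorm_ge0.
Qed.

Lemma ge0_ReC (R : realType) (c : R[i]) : 0 <= c -> c = (complex.Re c)%:C.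
Proof. by move=> c0; rewrite RRe_real// ger0_real. Qed.

(** The inner product b need not induce the norm: it suffices that it dominates
    the squared norm and is continuous. *)
Lemma orthogonal_projection (R : realType) (V : normedModType R[i])
    (b : {dot V for Num.Def.conjC})
    (b_ge : forall x, `|x| ^+ 2 <= b x x)
    (b_cont : forall y, continuous (fun x => b x y : R[i]^o))
    (V_complete : forall F : set_system V,
      ProperFilter F -> cauchy F -> exists l : V, F --> l)
    (G : set V) (G_closed : closed G) (G0 : G 0)
    (GP : forall a x y, G x -> G y -> G (a *: x + y)) (z : V) :
  exists2 g, G g & forall h, G h -> b (z - g) h = 0.
Proof.
pose N x := complex.Re (b x x).
have NE x : b x x = (N x)%:C by rewrite -ge0_ReC// dnorm_ge0.
pose E := [set N (z - g) | g in G].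
have Einf : has_inf E.
  split; first by exists (N (z - 0)), 0.
  by exists 0 => _ [g _ <-]; rewrite -ler0c -NE dnorm_ge0.
pose d := inf E.
have dN g : G g -> d <= N (z - g).
  by move=> Gg; apply: ge_inf => //; [exact: Einf.2|exists g].
(* the filter of minimizing points: its limit is the projection *)
pose F := filter_from [set e : R | 0 < e]
  (fun e => [set g | G g /\ N (z - g) < d + e]).
have FF : ProperFilter F.
  apply: filter_from_proper.
    apply: filter_from_filter; first by exists 1 => /=.
    move=> e1 e2 /= e10 e20; exists (Num.min e1 e2) => /=.
      by rewrite lt_min e10.
    move=> g [Gg]; rewrite -ltrBlDl lt_min !ltrBlDl => /andP[? ?].
    by split.
  move=> e /= e0; have [_ [g Gg <-] ?] := inf_adherent e0 Einf.
  by exists g.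
have [g Fg] : exists l : V, F --> l.
  apply: V_complete; apply/cauchy_ballP => e e0.
  have eR := ge0_ReC (ltW e0).
  set r := complex.Re e in eR.
  have r0 : 0 < r by rewrite -ltcR -eR.
  pose A := [set g | G g /\ N (z - g) < d + r ^+ 2 / 4].
  have FA : F A by exists (r ^+ 2 / 4) => //=; rewrite divr_gt0// exprn_gt0.
  exists (A, A) => // -[x y] [/= [Gx xd] [Gy yd]].
  rewrite -ball_normE/=.
  (* the midpoint of x and y is in G, hence at squared distance at least d *)
  have Gm : G (2^-1 *: (x + y)).
    rewrite -[2^-1 *: _]addr0; apply: (GP) => //.
    by rewrite -[x]scale1r; exact: (GP).
  have := parallelogram b (z - x) (z - y).
  have -> : z - x + (z - y) = 2 *: (z - 2^-1 *: (x + y)).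
    rewrite scalerBr scalerA divff// scale1r scaler_nat mulr2n opprD.
    by rewrite addrACA.
  have -> : z - x - (z - y) = - (x - y).
    by rewrite opprB addrC addrA subrK opprB.
  rewrite -(scaleN1r (x - y)) !dnormZ normrN normr1 expr1n mul1r normr_nat !NE.
  have bxy := b_ge (x - y).
  rewrite NE in bxy.
  have := dN _ Gm; move: (N (z - 2^-1 *: _)) => m dm.
  have {1}-> : 2 ^+ 2 = ((2 ^+ 2)%:C : R[i]) by rewrite rmorphXn rmorph_nat.
  rewrite -!rmorphM -!rmorphD/= -rmorphMn => -[Nxy].
  have Nlt : N (x - y) < r ^+ 2 by lra.
  have : `|x - y| ^+ 2 < e ^+ 2.
    by apply: (le_lt_trans bxy); rewrite eR -rmorphXn/= ltcR.
  by rewrite ltr_pXn2r ?nnegrE ?(ltW e0).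
exists g.
  (* G belongs to the filter, so that the limit stays in G *)
  have FG : F G by exists 1 => //= x [].
  exact: (@closed_cvg _ _ F _ idfun G G_closed FG _ Fg).
move=> h Gh.
(* along F, the inner product of z - x with h tends both to that of z - g
   and to zero *)
have lim1 : (b (z - x) h : R[i]^o) @[x --> F] --> (b (z - g) h : R[i]^o).
  apply: (cvg_comp (fun x => z - x) (b^~ h) _ (b_cont h (z - g))).
  by apply: cvgB; [exact: cvg_cst | exact: Fg].
have lim0 : (b (z - x) h : R[i]^o) @[x --> F] --> (0 : R[i]^o).
  apply/cvgrPdist_lt => e e0.
  have eR := ge0_ReC (ltW e0).
  set r := complex.Re e in eR.
  have r0 : 0 < r by rewrite -ltcR -eR.
  (* the 1 covers the case where h is zero *)
  pose e1 := r ^+ 2 / (N h + 1).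
  have Nh0 : 0 <= N h by rewrite -ler0c -NE dnorm_ge0.
  have e10 : 0 < e1 by rewrite divr_gt0 ?exprn_gt0// ltr_wpDl.
  exists e1 => // x [Gx xd] /=.
  rewrite sub0r normrN.
  suff : `|b (z - x) h| ^+ 2 < e ^+ 2 by rewrite ltr_pXn2r ?nnegrE ?(ltW e0).
  apply: (@le_lt_trans _ _ ((b (z - x) (z - x) - d%:C) * b h h)).
    apply: dnorm_min => a; rewrite NE lecR -addrA -opprD; apply: dN.
    by rewrite addrC; exact: (GP).
  rewrite !NE eR -rmorphB -rmorphM -rmorphXn/= ltcR.
  apply: (@le_lt_trans _ _ (e1 * N h)).
    by rewrite ler_wpM2r// lerBlDl ltW.
  rewrite /e1 mulrAC ltr_pdivrMr ?ltr_wpDl// ltr_pM2l ?exprn_gt0//.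
  by rewrite ltrDl.
exact: (cvg_unique _ lim1 lim0).
Qed.

(** * The inner product of a product space *)

Section PairDot.
Variables (C : numClosedFieldType) (U V : lmodType C).
Variables (b1 : {dot U for Num.Def.conjC}) (b2 : {dot V for Num.Def.conjC}).

(** The Hilbert sum of two inner products. *)
Definition pair_dot (p q : U * V) : C := b1 p.1 q.1 + b2 p.2 q.2.

Let pair_dot_zmodl q : zmod_morphism (pair_dot^~ q).
Proof. by move=> p p'; rewrite /pair_dot !linearBl addrACA opprD. Qed.

Let pair_dot_zmodr p : zmod_morphism (pair_dot p).
Proof. by move=> q q'; rewrite /pair_dot !linearBr addrACA opprD. Qed.

Let pair_dot_scall q : scalable_for *%R (pair_dot^~ q).
Proof. by move=> a p; rewrite /pair_dot !linearZl_LR mulrDr. Qed.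

Let pair_dot_scalr p : scalable_for (Num.Def.conjC \; *%R) (pair_dot p).
Proof. by move=> a q; rewrite /pair_dot !linearZr_LR /= mulrDr. Qed.

HB.instance Definition _ := isBilinear.Build C (U * V)%type (U * V)%type C
  *%R (Num.Def.conjC \; *%R) pair_dot
  pair_dot_zmodl pair_dot_zmodr pair_dot_scall pair_dot_scalr.

Let pair_dot_hermitian p q :
  pair_dot p q = (-1) ^+ false * Num.conj (pair_dot q p).
Proof.
by rewrite expr0 mul1r /pair_dot (hermC b1) (hermC b2) /= !expr0 !mul1r rmorphD.
Qed.
HB.instance Definition _ := isHermitianSesquilinear.Build C (U * V)%type
  false Num.Def.conjC pair_dot pair_dot_hermitian.

Let pair_dot_gt0 p : p != 0 -> 0 < pair_dot p p.
Proof.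
case: p => x y; rewrite xpair_eqE negb_and /pair_dot /= => /orP[] xy0.
- by rewrite ltr_pwDl ?dnorm_gt0// dnorm_ge0.
- by rewrite ltr_wpDl ?dnorm_gt0// dnorm_ge0.
Qed.
HB.instance Definition _ := isDotProduct.Build C (U * V)%type
  pair_dot pair_dot_gt0.
End PairDot.

Section Hilbert.
Variables (R : realType) (H : completeNormedModType R[i]).
Variables (ip : {dot H for Num.Def.conjC}) (ipH : hilbert ip).

Lemma ip_continuous (y : H) : continuous (fun x => ip x y : R[i]^o).
Proof.
move=> x; apply/cvgrPdist_lt => e e0.
have d0 : 0 < e / (`|y| + 1) by rewrite divr_gt0// ltr_wpDl.
have : \forall z \near x, `|x - z| < e / (`|y| + 1).
  by have := nbhsx_ballx x _ d0; rewrite -ball_normE.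
apply: filterS => z xz /=; rewrite -linearBl.
have : `|ip (x - z) y| ^+ 2 <= (`|x - z| * `|y|) ^+ 2.
  by rewrite exprMn -!ipH; exact: CauchySchwarz_dot.
rewrite ler_pXn2r ?nnegrE ?mulr_ge0// => /le_lt_trans; apply.
move: xz; rewrite ltr_pdivlMr ?ltr_wpDl//; apply: le_lt_trans.
by rewrite ler_wpM2l// lerDl.
Qed.

Lemma closed_ip_eq (x y : H) : closed [set p : H * H | ip p.1 x = ip p.2 y].
Proof.
have -> : [set p : H * H | ip p.1 x = ip p.2 y] =
    (fun p : H * H => ip p.1 x - ip p.2 y : R[i]^o) @^-1` [set 0].
  apply/seteqP; split => p /=; first by move=> ->; rewrite subrr.
  by move=> /eqP; rewrite subr_eq0 => /eqP.
apply: closed_comp.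
  move=> p _; apply: cvgB.
    apply: (@continuous_comp _ _ (R[i]^o) (@fst H H) (ip^~ x)).
      exact: cvg_fst.
    exact: ip_continuous.
  apply: (@continuous_comp _ _ (R[i]^o) (@snd H H) (ip^~ y)).
    exact: cvg_snd.
  exact: ip_continuous.
exact/accessible_closed_set1/hausdorff_accessible/norm_hausdorff.
Qed.

Lemma closed_adjoint_graph (S : operator H) : closed (adjoint_graph ip S).
Proof.
have -> : adjoint_graph ip S =
    \bigcap_(x in dom S) [set p : H * H | ip p.1 (S x) = ip p.2 x].
  have ipC u v : ip u v = Num.conj (ip v u) by rewrite hermC /= expr0 mul1r.
  apply/seteqP; split => p Sp x Sx /=; first by rewrite ipC Sp// -ipC.
  by rewrite ipC (Sp x Sx) -ipC.
by apply: closed_bigI => x _; exact: closed_ip_eq.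
Qed.

Lemma pair_projection (G : set (H * H)) (G_closed : closed G) (G0 : G (0, 0))
    (GP : forall a p q, G p -> G q -> G (a *: p + q)) (z : H * H) :
  exists2 g, G g & forall h, G h -> pair_dot ip ip (z - g) h = 0.
Proof.
apply: orthogonal_projection => //.
- move=> [x y]; change (`|(x, y)| ^+ 2 <= ip x x + ip y y).
  rewrite !ipH prod_normE /Num.max /=.
  by case: ifP => _; rewrite (lerDl, lerDr) exprn_ge0.
- move=> [x y] p; apply: cvgD.
    apply: (@continuous_comp _ _ (R[i]^o) (@fst H H) (ip^~ x)).
      exact: cvg_fst.
    exact: ip_continuous.
  apply: (@continuous_comp _ _ (R[i]^o) (@snd H H) (ip^~ y)).
    exact: cvg_snd.
  exact: ip_continuous.
- exact: prod_cauchy_cvg.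
Qed.
End Hilbert.

(** * Operators and their graphs *)

Section Graphs.
Context {R : realType} {H : completeNormedModType R[i]}.
Implicit Types S T : operator H.

Lemma op_subP S T : op_sub S T <-> graph S `<=` graph T.
Proof.
split=> [[ST STE] [x _] [/= Sx <-]|ST].
  by split=> /=; [exact: ST | rewrite STE].
by split=> x Sx; have [] := ST (x, S x) (conj Sx erefl).
Qed.

Lemma op_eqP S T : op_eq S T <-> graph S = graph T.
Proof.
split=> [[/op_subP ST /op_subP TS]|ST]; first exact/seteqP.
by split; apply/op_subP; rewrite ST.
Qed.

Lemma graph_linear S a (p q : H * H) :
  graph S p -> graph S q -> graph S (a *: p + q).
Proof.
case: p q => [x _] [y _] [/= Sx <-] [/= Sy <-].
by split=> /=; [exact: domP | exact: Defs.appP].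
Qed.

Lemma graph0 S : graph S (0, 0).
Proof. by split; [exact: dom0 | exact: op_app0]. Qed.

Lemma op_appB S x y : dom S x -> dom S y -> S (x - y) = S x - S y.
Proof.
by move=> Sx Sy; rewrite addrC -(scaleN1r y) Defs.appP// scaleN1r addrC.
Qed.

Lemma op_mul_eq S S' T T' :
  op_eq S S' -> op_eq T T' -> op_eq (op_mul S T) (op_mul S' T').
Proof.
move=> [[S1 S1E] [S2 S2E]] [[T1 T1E] [T2 T2E]].
split; split=> x [Tx STx] /=.
- by split; [exact: T1 | rewrite -T1E//; exact: S1].
- by rewrite -T1E// -S1E.
- by split; [exact: T2 | rewrite -T2E//; exact: S2].
- by rewrite -T2E// -S2E.
Qed.

Lemma densely_defined_sub S T :
  op_sub S T -> densely_defined S -> densely_defined T.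
Proof.
move=> [ST _] Sd O O0 Oo; have [x [Ox Sx]] := Sd O O0 Oo.
by exists x; split=> //; exact: ST.
Qed.

Variables (ip : {dot H for Num.Def.conjC}) (ipH : hilbert ip).

Lemma adjoint_graph_sub S T :
  op_sub S T -> adjoint_graph ip T `<=` adjoint_graph ip S.
Proof. by move=> [ST STE] p Tp x Sx; rewrite STE// Tp//; exact: ST. Qed.

Lemma symmetric_operatorP S : symmetric_operator ip S ->
  forall x y, dom S x -> dom S y -> ip (S x) y = ip x (S y).
Proof.
move=> [Sd /op_subP]; rewrite adjointE// => SS x y Sx Sy.
by have := SS (y, S y) (conj Sy erefl) x Sx.
Qed.

Lemma self_adjointP S :
  self_adjoint ip S <-> densely_defined S /\ graph S = adjoint_graph ip S.
Proof.
by split=> -[Sd]; [move/op_eqP | move=> SS]; rewrite ?adjointE//; split=> //;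
   apply/op_eqP; rewrite adjointE.
Qed.

Lemma self_adjoint_eq S T : op_eq S T -> self_adjoint ip S -> self_adjoint ip T.
Proof.
move=> ST /self_adjointP[Sd SE]; apply/self_adjointP.
case: (ST) => ST1 ST2; split; first exact: densely_defined_sub Sd.
move/op_eqP: ST => <-; rewrite SE; apply/seteqP.
by split; exact: adjoint_graph_sub.
Qed.

Lemma self_adjoint_closed S : self_adjoint ip S -> closed_operator S.
Proof.
move=> /self_adjointP[_ SE]; rewrite /closed_operator SE.
exact: closed_adjoint_graph.
Qed.

Lemma self_adjoint_normal S : self_adjoint ip S -> normal_operator ip S.
Proof.
move=> Sa; split; [exact: Sa.1 | exact: self_adjoint_closed |].
have [_ SE] := Sa; have SS : op_eq S S by split; split.
case: (SE) => S1 S2; apply: (@op_mul_eq _ _ _ _ SE (conj S2 S1)).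
Qed.
End Graphs.

(** A bounded inverse as a total Lipschitz function. *)
Lemma boundedly_invertibleP (R : realType) (H : completeNormedModType R[i])
    (B : operator H) : boundedly_invertible B ->
  exists C : H -> H,
    [/\ exists2 M, 0 < M & forall x y, `|C x - C y| <= M * `|x - y|,
        forall x, dom B x -> C (B x) = x,
        forall x, dom B (C x) & forall x, B (C x) = x].
Proof.
move=> [C [[CT [M CM]] [_ CB] [_ [BC1 BC2]]]].
have Cd x : dom C x by rewrite CT.
exists C; split.
- (* M itself may be negative if H is trivial *)
  exists (`|M| + 1) => [|x y]; first by rewrite ltr_wpDl.
  rewrite -op_appB//; apply: (le_trans (CM _)).
  rewrite -[leLHS]ger0_norm; last exact: le_trans (CM _).
  by rewrite normrM normr_id ler_wpM2r// lerDl.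
- by move=> x Bx; apply: CB; split.
- by move=> x; have [_] := BC1 x I.
- by move=> x; exact: (esym (BC2 x I)).
Qed.

(** * The product of a self-adjoint operator and an invertible symmetric one *)

Section Product.
Context {R : realType} {H : completeNormedModType R[i]}.
Variables (ip : {dot H for Num.Def.conjC}) (ipH : hilbert ip).
Variables (A B T : operator H) (C : H -> H) (M : R[i]).
Hypotheses (A_self_adjoint : self_adjoint ip A).
Hypotheses (B_symmetric : symmetric_operator ip B).
Hypotheses (M_gt0 : 0 < M) (C_lip : forall x y, `|C x - C y| <= M * `|x - y|).
Hypotheses (CB : forall x, dom B x -> C (B x) = x).
Hypotheses (domC : forall x, dom B (C x)) (BC : forall x, B (C x) = x).
Hypotheses (T_symmetric : symmetric_operator ip T).
Hypotheses (AB_sub_T : op_sub (op_mul A B) T).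

Let AE : graph A = adjoint_graph ip A.
Proof. by have /self_adjointP[] := A_self_adjoint. Qed.

Let symA x y : dom A x -> dom A y -> ip (A x) y = ip x (A y).
Proof. by move=> Ax Ay; have : graph A (y, A y) by []; rewrite AE => ->. Qed.

Lemma inverse_symmetric x y : ip (C x) y = ip x (C y).
Proof.
by rewrite -{1}[y]BC -{2}[x]BC (symmetric_operatorP ipH B_symmetric).
Qed.

(** As AB C p = A p, the graph of AB consists of the (C p, A p), p in D(A). *)
Lemma dom_AB_C p : dom A p -> dom (op_mul A B) (C p).
Proof. by move=> Ap; split; rewrite ?BC. Qed.

(** The range D(B) of C is dense, and C maps the dense set D(A) to a dense
    subset of it by continuity. *)
Lemma AB_densely_defined : densely_defined (op_mul A B).
Proof.
move=> O O0 Oo; have [y [Oy By]] := B_symmetric.1 O O0 Oo.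
have /nbhs_ballP[e /= e0 yO] : nbhs y O by exact: open_nbhs_nbhs.
have [] := A_self_adjoint.1 (ball (B y) (e / M)).
- by exists (B y); apply: ballxx; rewrite divr_gt0.
- exact: ball_open.
move=> a [Bya Aa]; exists (C a); split; last exact: dom_AB_C.
apply: yO; move: Bya; rewrite -!ball_normE /= ltr_pdivlMr// mulrC.
by rewrite -{2}[y]CB//; apply: le_lt_trans.
Qed.

(** This is where the hypothesis that AB has a symmetric extension is used. *)
Lemma inverse_commute z : dom A z -> dom A (C z) /\ A (C z) = C (A z).
Proof.
move=> Az; suff : graph A (C z, C (A z)) by [].
have TC p : dom A p -> dom T (C p) /\ T (C p) = A p.
  move=> Ap; have [ABT ABTE] := AB_sub_T; have ABp := dom_AB_C Ap.
  by split; [exact: ABT | rewrite -ABTE//= BC].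
rewrite AE => x Ax /=; have [Tx TxE] := TC x Ax; have [Tz TzE] := TC z Az.
rewrite -TxE (symmetric_operatorP ipH T_symmetric)// TzE.
exact: inverse_symmetric.
Qed.

Lemma AB_sub_BA : op_sub (op_mul A B) (op_mul B A).
Proof.
split=> x [Bx ABx]; have [ACB ACBE] := inverse_commute ABx.
  by rewrite CB// in ACB ACBE; split=> //; rewrite ACBE.
by rewrite CB// in ACBE; rewrite /= ACBE BC.
Qed.

Lemma adjoint_AB : adjoint_graph ip (op_mul A B) = graph (op_mul B A).
Proof.
apply/seteqP; split=> [[y w] ABy|[y _] [/= [Ay BAy] <-] x [Bx ABx] /=].
  have [/= Ay AyE] : graph A (y, C w).
    rewrite AE => p Ap /=; rewrite -inverse_symmetric.
    by have := ABy _ (dom_AB_C Ap); rewrite /= BC.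
  by split=> /=; [split=> //; rewrite AyE | rewrite AyE BC].
by rewrite symA// (symmetric_operatorP ipH B_symmetric).
Qed.

Lemma BA_closed : closed_operator (op_mul B A).
Proof.
by rewrite /closed_operator -adjoint_AB; exact: closed_adjoint_graph.
Qed.

(** The graph of AB is dense in that of BA. *)
Lemma closure_AB : closure (graph (op_mul A B)) = graph (op_mul B A).
Proof.
have ABc : closable (op_mul A B).
  by exists (op_mul B A); [exact: AB_sub_BA | exact: BA_closed].
have /op_subP ABBA := AB_sub_BA.
have cBA : closure (graph (op_mul A B)) `<=` graph (op_mul B A).
  by apply: (subset_trans (closureS ABBA)); exact: BA_closed.
apply/seteqP; split=> // z BAz; rewrite -op_closureE//.
have [g Gg gO] : exists2 g, graph (op_closure (op_mul A B)) g &
    forall h, graph (op_closure (op_mul A B)) h -> pair_dot ip ip (z - g) h = 0.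
  apply: (pair_projection ipH).
  - by rewrite op_closureE//; exact: closed_closure.
  - exact: graph0.
  - by move=> a p q; exact: graph_linear.
(* z - g lies in the graph of BA and is orthogonal to that of AB *)
suff /eqP : z - g = 0 by rewrite subr_eq0 => /eqP ->.
have : graph (op_mul B A) (z - g).
  rewrite addrC -scaleN1r; apply: graph_linear => //.
  by apply: cBA; rewrite -op_closureE.
case: (z - g) gO => y v gO [/= [Ay BAy] BAyE].
have AyE : A y = C v by rewrite -BAyE CB.
have [/= Av AvE] : graph A (v, - C y).
  rewrite AE => p Ap /=.
  have : pair_dot ip ip (C p, A p) (y, v) = 0.
    rewrite hermC /= gO ?rmorph0 ?mulr0// op_closureE//.
    by apply: subset_closure; split=> /=; [exact: dom_AB_C | rewrite BC].
  rewrite /pair_dot /= inverse_symmetric addrC => /eqP.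
  by rewrite addr_eq0 => /eqP ->; rewrite linearNr.
have [ACv ACvE] := inverse_commute Av.
(* A (A y) = A (C v) = C (A v) = - C (C y) *)
have AyAy : ip (A y) (A y) = - ip (C y) (C y).
  have AAy : dom A (A y) by rewrite AyE.
  by rewrite -symA// {1}AyE ACvE AvE inverse_symmetric linearNl.
have Cy0 : ip (C y) (C y) = 0.
  apply/eqP; rewrite eq_le dnorm_ge0 andbT -oppr_ge0 -AyAy.
  exact: dnorm_ge0.
have /eqP Ay0 : A y == 0 by rewrite -(dnorm_eq0 ip) AyAy Cy0 oppr0.
move: Cy0 => /eqP; rewrite dnorm_eq0 => /eqP Cy0.
by congr (_, _); rewrite -[LHS]BC ?Cy0 -?AyE ?Ay0 op_app0.
Qed.

Lemma BA_self_adjoint : self_adjoint ip (op_mul B A).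
Proof.
apply/self_adjointP => //; split.
  exact: densely_defined_sub AB_sub_BA AB_densely_defined.
apply/seteqP; split; last first.
  by rewrite -adjoint_AB; exact: (adjoint_graph_sub AB_sub_BA).
move=> [y w] BAy x BAx /=.
(* for fixed y the symmetry relation is closed in the graph of BA, and it
   holds on the graph of AB *)
suff : closure (graph (op_mul A B)) `<=` [set p | ip p.1 w = ip p.2 y].
  rewrite closure_AB => /(_ (x, op_mul B A x)) /= <- //.
apply: (@subset_trans _ (closure [set p | ip p.1 w = ip p.2 y])); last first.
  exact: closed_ip_eq.
apply: closureS => -[u _] [/= ABu <-].
by move: BAy; rewrite -adjoint_AB => ->.
Qed.

(** T <= T* <= (AB)* = BA. *)
Lemma T_sub_BA : op_sub T (op_mul B A).
Proof.
apply/op_subP; rewrite -adjoint_AB.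
have [Td /op_subP] := T_symmetric; rewrite adjointE// => TT.
exact: (subset_trans TT (adjoint_graph_sub AB_sub_T)).
Qed.

Lemma closure_T : closure (graph T) = graph (op_mul B A).
Proof.
have /op_subP TBA := T_sub_BA; have /op_subP ABT := AB_sub_T.
apply/seteqP; split; first exact: (subset_trans (closureS TBA) BA_closed).
by rewrite -closure_AB; exact: closureS.
Qed.
End Product.

Theorem theorem3p6 (R : realType) (H : completeNormedModType R[i]%C)
    (ip : {dot H for Num.Def.conjC}%R) (ip_hilbert : hilbert ip)
    (A B T : operator H)
    (A_self_adjoint : self_adjoint ip A)
    (B_symmetric : symmetric_operator ip B)
    (B_invertible : boundedly_invertible B)
    (T_symmetric : symmetric_operator ip T)
    (AB_sub_T : op_sub (op_mul A B) T) :
  [/\ op_sub (op_mul A B) (op_mul B A),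
      normal_operator ip (op_mul B A),
      op_eq (op_closure T) (adjoint ip (op_mul B A))
    & essentially_self_adjoint ip T] /\
  (closed_operator T ->
   [/\ self_adjoint ip (op_mul B A),
       op_eq T (op_mul B A)
     & op_eq T (op_closure (op_mul A B))]).
Proof.
have [C [[M M0 CM] CB domC BC]] := boundedly_invertibleP B_invertible.
have ABBA := AB_sub_BA ip_hilbert A_self_adjoint B_symmetric CB domC BC
  T_symmetric AB_sub_T.
have BAsa : self_adjoint ip (op_mul B A).
  exact: (@BA_self_adjoint _ _ ip ip_hilbert A B T C M).
have BAc := self_adjoint_closed ip_hilbert BAsa.
have clT : closure (graph T) = graph (op_mul B A).
  exact: (@closure_T _ _ ip ip_hilbert A B T C).
have clAB : closure (graph (op_mul A B)) = graph (op_mul B A).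
  exact: (@closure_AB _ _ ip ip_hilbert A B T C).
have TBA : op_sub T (op_mul B A).
  exact: (@T_sub_BA _ _ ip ip_hilbert A B T C).
have clTE : op_eq (op_closure T) (op_mul B A).
  by apply/op_eqP; rewrite op_closureE//; exists (op_mul B A).
have clABE : op_eq (op_closure (op_mul A B)) (op_mul B A).
  by apply/op_eqP; rewrite op_closureE//; exists (op_mul B A).
split.
  split=> //; first exact: self_adjoint_normal.
    apply/op_eqP; have [_ /op_eqP <-] := BAsa; exact/op_eqP.
  split; first exact: T_symmetric.1.
  by apply: (self_adjoint_eq ip_hilbert _ BAsa); case: clTE.
move=> Tc.
have TE : op_eq T (op_mul B A).
  by apply/op_eqP; rewrite -clT; exact/closure_id.
split=> //.
by apply/op_eqP; move/op_eqP: TE => ->; apply/esym/op_eqP.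
Qed.
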